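(* For every $p\geq 2$, there exists, up to isomorphism, exactly one $2p$-regular $(p+2)$-star colourable graph $G_{2p}$ on $(p+1)(p+2)$ vertices. Moreover, $G_{2p}$ is vertex-transitive, edge-transitive and Hamiltonian for every $p\geq 2$.
   Context: A $k$-star colouring of a graph is a proper vertex colouring with $k$ colours in which no path on 4 vertices receives only two colours. (Explicitly, $G_{2p}$ has vertex set $\{(i,j): i,j\in\{0,\dots,p+1\}, i\neq j\}$, with $(i,j)$ adjacent to $(k,\ell)$ iff either $k=j$ and $\ell\notin\{i,j\}$, or $k\notin\{i,j\}$ and $\ell=i$.) *)

(* Defs.v *)
From mathcomp Require Import all_boot perm.

Set Implicit Arguments.
Unset Strict Implicit.
Unset Printing Implicit Defensive.

Record sgraph := SGraph {
  vertex :> finType;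
  adj : rel vertex;
  adj_sym : symmetric adj;
  adj_irrefl : irreflexive adj
}.

Definition regular (d : nat) (G : sgraph) : Prop :=
  forall x : G, #|[set y | adj x y]| = d.

Definition proper_colouring (G : sgraph) (k : nat) (f : G -> 'I_k) : Prop :=
  forall x y : G, adj x y -> f x != f y.

(* The 4-vertex paths are subgraphs, not necessarily induced. *)
Definition star_colouring (G : sgraph) (k : nat) (f : G -> 'I_k) : Prop :=
  proper_colouring f /\
  forall a b c d : G, uniq [:: a; b; c; d] -> path (@adj G) a [:: b; c; d] ->
    #|[set f x | x in [:: a; b; c; d]]| != 2.

(* Not all k colours need be used. *)
Definition star_colourable (k : nat) (G : sgraph) : Prop :=
  exists f : G -> 'I_k, star_colouring f.

Definition isomorphic (G H : sgraph) : Prop :=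
  exists2 h : G -> H, bijective h & forall x y, adj (h x) (h y) = adj x y.

Definition automorphism (G : sgraph) (s : {perm G}) : Prop :=
  forall x y, adj (s x) (s y) = adj x y.

Definition vertex_transitive (G : sgraph) : Prop :=
  forall x y : G, exists2 s : {perm G}, automorphism s & s x = y.

Definition edge_transitive (G : sgraph) : Prop :=
  forall a b c d : G, adj a b -> adj c d ->
    exists2 s : {perm G}, automorphism s & [set s a; s b] = [set c; d].

(* The bound on the size is needed because [cycle] accepts the empty sequence
   and, for an edge ab, the sequence [:: a; b]. *)
Definition hamiltonian (G : sgraph) : Prop :=
  exists c : seq G, [/\ 2 < size c, ucycle (@adj G) c & forall x, x \in c].

Definition G2p_vertex (p : nat) : finType :=
  {ij : 'I_p.+2 * 'I_p.+2 | ij.1 != ij.2}.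

Definition G2p_adj (p : nat) : rel (G2p_vertex p) := fun u v =>
  let: (i, j) := val u in let: (k, l) := val v in
  (k == j) && (l \notin [:: i; j]) || (k \notin [:: i; j]) && (l == i).

Lemma G2p_adj_sym (p : nat) : symmetric (@G2p_adj p).
Proof.
move=> [[i j] /= ij] [[k l] /= kl]; rewrite /G2p_adj /= !inE !negb_or.
rewrite (eq_sym i l) (eq_sym i k) (eq_sym j k) (eq_sym j l).
case: (eqVneq k j) ij kl => [<-|kj] ij kl; case: (eqVneq l i) ij => [<-|li] ij;
  rewrite ?andbT ?andbF ?orbF //=.
- by rewrite (eq_sym l) kl (eq_sym k) ij.
- by rewrite kl ij.
Qed.

Lemma G2p_adj_irrefl (p : nat) : irreflexive (@G2p_adj p).
Proof.
by move=> [[i j] /= ij]; rewrite /G2p_adj /= !inE !eqxx orbT andbF.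
Qed.

Definition G2p (p : nat) : sgraph :=
  SGraph (@G2p_adj_sym p) (@G2p_adj_irrefl p).

(* Main.v *)
(* Fix a star colouring f of a 2p-regular graph with p+2 colours. If v and w are
   adjacent, one of them has the other as its only neighbour of that colour:
   otherwise there is a bicoloured P4. Call v a leaf of colour c if it has
   exactly one neighbour of colour c. As 2p > p+1, a vertex is a leaf for at most
   p colours; since there are p|G| edges, this is tight everywhere, so each v
   has exactly one colour g v <> f v of which it is not a leaf, and each edge vw
   satisfies exactly one of g v = f w and g w = f v. Hence v |-> (f v, g v)
   is a homomorphism to G_2p. Its image is closed under (i,j) |-> (k,i) with
   k, i, j distinct, so it is onto; when the orders agree it is bijective, and by
   regularity an isomorphism.

   Symmetry of G_2p comes from the symmetric group acting on the p+2 symbols.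
   A Hamiltonian cycle on the symbols 0..n-1 is extended to a new symbol n by
   replacing one edge by a Hamiltonian path through the pairs containing n, which
   induce a complete bipartite graph minus a perfect matching. *)

Require Import Defs.
From mathcomp Require Import all_boot perm zify.

Set Implicit Arguments.
Unset Strict Implicit.
Unset Printing Implicit Defensive.

(** * The graph G_2p and its symmetries *)

Section Arcs.
Variable T : eqType.
Implicit Types u v : T * T.

(** Pairs are read as arcs: [v] continues [u] without turning back. The type is arbitrary so that
    pairs of naturals can be used for the Hamiltonian cycle. *)
Definition arc_succ u v := (u.2 == v.1) && (u.1 != v.2).
Definition arc_adj u v := arc_succ u v || arc_succ v u.

Lemma arc_adj_sym : symmetric arc_adj.
Proof. by move=> u v; rewrite /arc_adj orbC. Qed.

End Arcs.

(** A properly coloured path with exactly two colours must alternate them. *)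
Lemma star_colouring_alternating (G : sgraph) k (f : G -> 'I_k) :
  proper_colouring f ->
  (forall a b c d : G, uniq [:: a; b; c; d] -> path (@adj G) a [:: b; c; d] ->
     f c = f a -> f d <> f b) ->
  star_colouring f.
Proof.
move=> f_proper no_alt; split=> // a b c d abcd abcd_path; apply/eqP => im2.
have /and4P[ab bc cd _] := abcd_path.
have fE : [set f a; f b] = [set f x | x in [:: a; b; c; d]].
  apply/eqP; rewrite eqEcard im2 cards2 f_proper // andbT.
  by apply/subsetP => x /set2P[] ->; rewrite imset_f // !inE eqxx ?orbT.
have fc : f c \in [set f a; f b] by rewrite fE imset_f // !inE eqxx ?orbT.
have fd : f d \in [set f a; f b] by rewrite fE imset_f // !inE eqxx ?orbT.
case/set2P: fc => fc; last by have := f_proper _ _ bc; rewrite fc eqxx.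
case/set2P: fd => fd; first by have := f_proper _ _ cd; rewrite fc fd eqxx.
exact: no_alt abcd abcd_path fc fd.
Qed.

Section G2p.
Variable p : nat.
Implicit Types (u v : G2p p) (i j k : 'I_p.+2).

Lemma G2p_eq u v : (val u).1 = (val v).1 -> (val u).2 = (val v).2 -> u = v.
Proof.
move=> e1 e2; apply: val_inj.
by rewrite [LHS]surjective_pairing e1 e2 -surjective_pairing.
Qed.

(** The remaining inequalities of [G2p_adj] follow from the entries of a vertex being distinct. *)
Lemma G2p_adjE u v : adj u v = arc_adj (val u) (val v).
Proof.
case: u v => [[i j] /= ij] [[k l] /= kl].
rewrite /adj /= /G2p_adj /arc_adj /arc_succ /= !inE !negb_or.
rewrite (eq_sym i l) (eq_sym j k).
case: (eqVneq k j) => [e|_] /=; case: (eqVneq l i) => [e'|_] //=.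
- by rewrite andbF.
- by rewrite -e (eq_sym l) kl.
- by rewrite -e' kl.
- by rewrite andbF.
Qed.

Lemma G2p_sur i j : i != j -> exists u : G2p p, val u = (i, j).
Proof. by move=> ij; exists (Sub (i, j) ij). Qed.

Lemma card_setC2 i j : i != j -> #|~: [set i; j]| = p.
Proof.
move=> ij; have := cardsC [set i; j].
by rewrite cards2 ij card_ord !add2n => -[].
Qed.

Lemma card_G2p : #|G2p p| = p.+1 * p.+2.
Proof.
rewrite card_sig -sum1_card.
rewrite (eq_bigl (fun x : 'I_p.+2 * 'I_p.+2 => true && (x.1 != x.2))) //.
rewrite -(pair_big_dep xpredT (fun i j => i != j) (fun _ _ => 1)) /=.
rewrite (eq_bigr (fun=> p.+1)); first by rewrite sum_nat_const card_ord mulnC.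
move=> i _; rewrite sum1_card; transitivity #|[set~ i]|.
  by apply: eq_card => j; rewrite !inE unfold_in eq_sym.
by rewrite cardsC1 card_ord.
Qed.

Lemma G2p_regular : regular (2 * p) (G2p p).
Proof.
move=> x; case E: (val x) => [i j]; have ij : i != j.
  by have := valP x; rewrite E.
pose S := ~: [set i; j]; pose vs := [set val y | y in [set y | adj x y]].
have <- : #|vs| = #|[set y | adj x y]| by apply: card_imset; apply: val_inj.
(* Arcs leaving and arcs entering [(i, j)]: [p] of each, disjoint since [j] is not in [S]. *)
suff -> : vs = [set (j, l) | l in S] :|: [set (k, i) | k in S].
  rewrite cardsU disjoint_setI0; last first.
    apply/pred0P => -[a b] /=; apply/negbTE/negP => /andP[/imsetP[l lS [-> ->]]].
    by case/imsetP=> k kS [e _]; move: kS; rewrite -e !inE eqxx orbT.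
  by rewrite cards0 !card_imset ?card_setC2 ?subn0 ?mul2n ?addnn // => a b [].
apply/setP => -[a b]; rewrite inE; apply/imsetP/orP.
  case=> y; rewrite inE G2p_adjE /arc_adj E => xy Ey; move: xy (valP y).
  rewrite -Ey /arc_succ /= => /orP[] /andP[/eqP e n] ab; [left|right].
    by apply/imsetP; exists b; rewrite ?e // !inE negb_or eq_sym n e eq_sym ab.
  by apply/imsetP; exists a; rewrite -?e // !inE negb_or -e ab n.
case=> /imsetP[l]; rewrite !inE negb_or => /andP[li lj] [-> ->].
  have [|y Ey] := @G2p_sur j l; first by rewrite eq_sym.
  by exists y; rewrite // inE G2p_adjE /arc_adj E Ey /arc_succ /= eqxx eq_sym li.
have [//|y Ey] := @G2p_sur l i.
by exists y; rewrite // inE G2p_adjE /arc_adj E Ey /arc_succ /= eqxx lj orbT.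
Qed.

(** Arcs are coloured by their tail. Of two adjacent arcs exactly one points to the tail of the
    other, so an alternating path [a b c d] forces [a = c] or [b = d]. *)
Lemma G2p_star_colourable : star_colourable p.+2 (G2p p).
Proof.
pose f (v : G2p p) := (val v).1.
have f_proper : proper_colouring f.
  move=> x y; rewrite G2p_adjE /f /arc_adj /arc_succ.
  move: (valP x) (valP y); case: (val x) (val y) => i j [k l] /= ij kl.
  by case/orP=> /andP[/eqP <- _] //; rewrite eq_sym.
exists f; apply: star_colouring_alternating => // a b c d abcd.
case/and4P=> ab bc cd _ fca fdb.
have ac : val a != val c.
  by apply: contraTneq abcd => /val_inj->; rewrite /= !inE eqxx ?orbT.
have bd : val b != val d.
  by apply: contraTneq abcd => /val_inj->; rewrite /= !inE eqxx ?orbT ?andbF.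
move: ac bd ab bc cd fca fdb; rewrite !G2p_adjE /arc_adj /arc_succ /f.
case: (val a) (val b) (val c) (val d) => [a1 a2] [b1 b2] [c1 c2] [d1 d2] /=.
move=> ac bd + + + ? ?; subst c1 d1; move: ac bd.
rewrite !xpair_eqE !eqxx /= => ac bd.
case/orP=> /andP[/eqP ? n1] /orP[] /andP[/eqP ? n2] /orP[] /andP[/eqP ? n3];
  by subst; rewrite ?eqxx in ac bd n1 n2 n3.
Qed.

End G2p.

(** Used with two symbols for a vertex and three for an edge. The transposition that corrects the
    head fixes the images already placed. *)
Lemma perm_map_uniq (T : finType) (s t : seq T) :
  uniq s -> uniq t -> size s = size t -> exists u : {perm T}, map u s = t.
Proof.
elim: s t => [|x s IH] [|y t] //=; first by exists 1%g.
case/andP=> xs us /andP[yt ut] [/(IH _ us ut)[u E]].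
exists (u * tperm (u x) y)%g; rewrite permM tpermL -[in RHS]E; congr cons.
apply/eq_in_map => z zs; rewrite permM tpermD //.
  by apply: contraNneq xs => /perm_inj->.
by apply: contraNneq yt => ->; rewrite -E map_f.
Qed.

Section Symmetries.
Variable p : nat.

Lemma relabel_subproof (s : {perm 'I_p.+2}) (u : G2p p) :
  s (val u).1 != s (val u).2.
Proof. by rewrite (inj_eq perm_inj) (valP u). Qed.

Definition relabel (s : {perm 'I_p.+2}) (u : G2p p) : G2p p :=
  Sub (s (val u).1, s (val u).2) (relabel_subproof s u).

Lemma relabel_inj s : injective (relabel s).
Proof.
by move=> u v /(congr1 val) [/perm_inj e1 /perm_inj e2]; apply: G2p_eq.
Qed.

Definition relabel_perm (s : {perm 'I_p.+2}) : {perm G2p p} :=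
  perm (@relabel_inj s).

Lemma relabel_automorphism s : automorphism (relabel_perm s).
Proof.
move=> u v; rewrite !permE !G2p_adjE /arc_adj /arc_succ /=.
by rewrite !(inj_eq perm_inj).
Qed.

Lemma G2p_vertex_transitive : vertex_transitive (G2p p).
Proof.
move=> x y; have [|||s] := @perm_map_uniq _ [:: (val x).1; (val x).2]
  [:: (val y).1; (val y).2]; rewrite //= ?inE ?andbT ?(valP x) ?(valP y) //.
case=> e1 e2; exists (relabel_perm s); first exact: relabel_automorphism.
by apply: G2p_eq; rewrite permE.
Qed.

(** Two consecutive arcs amount to a list of three distinct symbols. *)
Lemma G2p_succ_transitive (a b c d : G2p p) :
  arc_succ (val a) (val b) -> arc_succ (val c) (val d) ->
  exists s, relabel_perm s a = c /\ relabel_perm s b = d.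
Proof.
move=> /andP[/eqP ab nab] /andP[/eqP cd ncd].
have [|||s] := @perm_map_uniq _ [:: (val a).1; (val a).2; (val b).2]
  [:: (val c).1; (val c).2; (val d).2]; rewrite //= ?inE ?negb_or ?nab ?ncd.
- by rewrite (valP a) ab (valP b).
- by rewrite (valP c) cd (valP d).
by case=> e1 e2 e3; exists s; split; apply: G2p_eq; rewrite permE //= -ab e2.
Qed.

Lemma G2p_edge_transitive : edge_transitive (G2p p).
Proof.
move=> a b c d; rewrite !G2p_adjE /arc_adj => /orP[] h1 /orP[] h2;
  have [s [e1 e2]] := G2p_succ_transitive h1 h2; exists (relabel_perm s);
  by [exact: relabel_automorphism | rewrite e1 e2 // setUC].
Qed.

End Symmetries.

(** * Uniqueness *)

(** Turns tightness of a global count into equality at each vertex and edge. *)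
Lemma sum_leq_eq (I : finType) (E1 E2 : I -> nat) :
  (forall i, E1 i <= E2 i) -> \sum_i E2 i <= \sum_i E1 i ->
  forall i, E1 i = E2 i.
Proof.
move=> le12 le21 i; apply/eqP.
have [] := leqif_sum (P := xpredT) (fun i _ => leqif_eq (le12 i)).
by move=> le; rewrite eqn_leq le le21 => /esym/forallP/(_ i).
Qed.

Section Uniqueness.
Variables (p : nat) (G : sgraph) (f : G -> 'I_p.+2).
Hypotheses (p_gt1 : 1 < p) (G_regular : regular (2 * p) G).
Hypothesis f_star : star_colouring f.
Implicit Types (v w : G) (c : 'I_p.+2).

Definition colour_degree v c := #|[set w | adj v w & f w == c]|.

Lemma sum_colour_degree v : \sum_c colour_degree v c = 2 * p.
Proof.
rewrite -(G_regular v) -sum1_card (partition_big f xpredT) //=.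
by apply: eq_bigr => c _; rewrite sum1_card; apply: eq_card => w;
  rewrite !inE unfold_in inE.
Qed.

Lemma colour_degree_own v : colour_degree v (f v) = 0.
Proof.
apply/eqP; rewrite cards_eq0; apply/eqP/setP => w; rewrite !inE.
by apply/negbTE/negP => /andP[/f_star.1]; rewrite eq_sym => /negbTE->.
Qed.

Lemma colour_degree_edge v w : adj v w ->
  (colour_degree v (f w) == 1) || (colour_degree w (f v) == 1).
Proof.
move=> vw; have wv : adj w v by rewrite adj_sym.
rewrite /colour_degree (cardsD1 w [set x | adj v x & _]).
rewrite (cardsD1 v [set x | adj w x & _]) !inE vw wv !eqxx /=.
apply: contraT; rewrite negb_or !eqSS !cards_eq0 => /andP[].
(* Second neighbours [x] of [v] and [y] of [w] would make [x v w y] a bicoloured path. *)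
case/set0Pn=> x; rewrite !inE => /and3P[xw vx /eqP fx].
case/set0Pn=> y; rewrite !inE => /and3P[yv wy /eqP fy].
have fvw := f_star.1 _ _ vw.
have xNv : x != v by apply: contraNneq fvw => <-; rewrite fx.
have yNw : y != w by apply: contraNneq fvw => <-; rewrite fy.
have xNy : x != y by apply: contraNneq fvw => e; rewrite -fx -fy e.
have := f_star.2 x v w y; rewrite /= !inE !negb_or xNv xw xNy vw wy (adj_sym x).
rewrite vx (eq_sym v y) yv (eq_sym w y) yNw.
rewrite (_ : v != w) /=; last by apply: contraNneq fvw => ->.
move=> /(_ isT isT); suff -> : [set f x | x in [:: x; v; w; y]] = [set f v; f w].
  by rewrite cards2 fvw.
apply/setP => c; apply/imsetP/set2P.
  by case=> z; rewrite !inE => /or4P[] /eqP-> ->; rewrite ?fx ?fy; auto.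
by case=> ->; [exists v | exists w]; rewrite ?inE ?eqxx ?orbT.
Qed.

Definition leaf_colours v := [set c | colour_degree v c == 1].

Lemma leaf_colours_own v : f v \notin leaf_colours v.
Proof. by rewrite inE colour_degree_own. Qed.

Lemma leq_leaf_colours v : #|leaf_colours v| <= p.
Proof.
have := subset_leqif_cards (_ : leaf_colours v \subset [set~ f v]).
have -> : leaf_colours v \subset [set~ f v].
  by rewrite subsetC sub1set inE leaf_colours_own.
rewrite cardsC1 card_ord => /(_ isT)[le /= eq].
(* If all colours but [f v] were leaf colours, [v] would have degree p + 1 < 2p. *)
rewrite -ltnS ltn_neqAle le eq andbT; apply/eqP => E.
have := sum_colour_degree v; rewrite (bigD1 (f v)) //= colour_degree_own.
rewrite (eq_bigr (fun=> 1)) => [|c cv].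
  rewrite sum1dep_card -[X in _ + X](_ : #|[set~ f v]| = _).
    by rewrite cardsC1 card_ord; lia.
  by apply: eq_card => c; rewrite !inE.
have : c \in leaf_colours v by rewrite E !inE.
by rewrite inE => /eqP.
Qed.

(** Directed: [v] is the leaf, with [w] its only neighbour of colour [f w]. *)
Definition leaf_edge v w := adj v w && (f w \in leaf_colours v).

Lemma sum_leaf_edge v : \sum_w leaf_edge v w = #|leaf_colours v|.
Proof.
rewrite -sum1_card (partition_big f xpredT) //= [RHS]big_mkcond /=.
apply: eq_bigr => c _; case: ifPn => cv.
  move: (cv); rewrite inE => /eqP <-; rewrite /colour_degree -sum1dep_card.
  rewrite big_mkcond [RHS]big_mkcond; apply: eq_bigr => w _.
  by rewrite /leaf_edge; case: eqP => [->|]; rewrite ?cv ?andbT ?andbF //; case: adj.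
by rewrite big1 // => w /eqP e; rewrite /leaf_edge e (negbTE cv) andbF.
Qed.

(* Every edge is a leaf edge at one of its ends, there are [p #|G|] edges and
   at most [p] leaf edges per vertex: all these bounds are attained. *)
Lemma leaf_edges_tight :
  (forall v, #|leaf_colours v| = p) /\
  (forall v w, adj v w = leaf_edge v w + leaf_edge w v :> nat).
Proof.
have adj_le v w : adj v w <= leaf_edge v w + leaf_edge w v.
  case E: (adj v w) => //; have := colour_degree_edge E.
  by rewrite /leaf_edge (adj_sym w) E !inE /=; case: eqP => // _ /= ->.
have sum_adj : \sum_(v : G) \sum_(w : G) adj v w = 2 * p * #|G|.
  transitivity (\sum_(v : G) 2 * p); last by rewrite sum_nat_const mulnC.
  apply: eq_bigr => v _.
  rewrite -(G_regular v) -sum1dep_card [RHS]big_mkcond /=.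
  by apply: eq_bigr => w _; case: adj.
have sum_leaf : \sum_v \sum_w (leaf_edge v w + leaf_edge w v) =
    2 * \sum_v #|leaf_colours v|.
  under eq_bigr do rewrite big_split /= sum_leaf_edge.
  rewrite big_split /= exchange_big /= mul2n -addnn; congr (_ + _).
  by apply: eq_bigr => v _; rewrite sum_leaf_edge.
have sum_p : \sum_(v : G) p = p * #|G| by rewrite sum_nat_const mulnC.
have sum_colours : \sum_v #|leaf_colours v| <= p * #|G|.
  by rewrite -sum_p; apply: leq_sum => v _; apply: leq_leaf_colours.
have sum_le : \sum_(v : G) \sum_(w : G) adj v w <=
    \sum_v \sum_w (leaf_edge v w + leaf_edge w v).
  by apply: leq_sum => v _; apply: leq_sum => w _.
split=> [|v w].
  apply: sum_leq_eq; first exact: leq_leaf_colours.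
  by rewrite sum_p -(leq_pmul2l (isT : 0 < 2)) mulnA -sum_adj -sum_leaf.
apply: (sum_leq_eq (E1 := fun w => adj v w : nat)
  (E2 := fun w => leaf_edge v w + leaf_edge w v)) => //.
suff -> : \sum_(w : G) adj v w = \sum_w (leaf_edge v w + leaf_edge w v) by [].
apply: (sum_leq_eq (E1 := fun v : G => \sum_(w : G) adj v w)
  (E2 := fun v => \sum_w (leaf_edge v w + leaf_edge w v))).
  by move=> x; apply: leq_sum => y _.
by rewrite sum_leaf sum_adj -mulnA leq_pmul2l.
Qed.

(* [g v] is the colour of the leaves of the star centred at [v]. *)
Lemma centre_colour_exists :
  exists g : G -> 'I_p.+2, forall v, ~: leaf_colours v = [set f v; g v].
Proof.
suff /fin_all_exists[g gP] v : exists j, ~: leaf_colours v = [set f v; j].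
  by exists g.
have := cardsC (leaf_colours v).
rewrite leaf_edges_tight.1 card_ord (cardsD1 (f v)) inE leaf_colours_own.
move=> E; have /cards1P[j Ej] : #|~: leaf_colours v :\ f v| == 1 by lia.
by exists j; rewrite -Ej setD1K // inE leaf_colours_own.
Qed.

(** * The isomorphism given by colour and centre colour *)

Section CentreColour.
Variable g : G -> 'I_p.+2.
Hypothesis gP : forall v, ~: leaf_colours v = [set f v; g v].

Lemma leaf_coloursE v c : (c \in leaf_colours v) = (c != f v) && (c != g v).
Proof. by rewrite -[leaf_colours v]setCK gP !inE negb_or. Qed.

Lemma centre_colour_neq v : f v != g v.
Proof.
have := cardsC (leaf_colours v).
by rewrite leaf_edges_tight.1 gP card_ord cards2; case: eqP => // _; lia.
Qed.

(** By tightness exactly one end of the edge is a leaf, and [v] is a leaf of colour [f w] unless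
    [g v = f w]. *)
Lemma edge_centre v w : adj v w -> (g v == f w) = (g w != f v).
Proof.
move=> vw; have := leaf_edges_tight.2 v w; have := f_star.1 _ _ vw.
rewrite /leaf_edge (adj_sym w) vw !leaf_coloursE /= (eq_sym (f w)) => fvw.
rewrite fvw /= (eq_sym (f w)) (eq_sym (f v)).
by case: eqP; case: eqP.
Qed.

Definition to_G2p v : G2p p := Sub (f v, g v) (centre_colour_neq v).

Lemma to_G2p_homo v w : adj v w -> adj (to_G2p v) (to_G2p w).
Proof.
move=> vw; rewrite G2p_adjE /arc_adj /arc_succ /= (eq_sym (f w)) (eq_sym (f v)).
by rewrite (edge_centre vw); case: (g w == f v).
Qed.

Let P i j := exists2 v, f v = i & g v = j.

(** A preimage [v] of [(i, j)] is a leaf of colour [k], so its only neighbour [w] of that colour has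
    [g w = f v]. *)
Lemma to_G2p_step i j k : P i j -> k != i -> k != j -> P k i.
Proof.
move=> [v <- <-] ki kj; have : k \in leaf_colours v by rewrite leaf_coloursE ki.
rewrite inE => /cards1P[w /setP/(_ w)]; rewrite !inE eqxx => /andP[vw /eqP fw].
exists w => //; apply/eqP; move: (edge_centre vw); rewrite fw eq_sym (negbTE kj).
by case: eqP.
Qed.

(** Steps through a spare symbol compose to change one entry at a time; avoiding three symbols is
    possible as p + 2 is at least 4. *)
Lemma to_G2p_connected a b x y : P a b -> x != y -> P x y.
Proof.
have fresh (s : seq 'I_p.+2) : size s < 4 -> exists k, k \notin s.
  move=> s4; suff /subsetPn[k _ ks] : ~~ (predT \subset s) by exists k.
  apply/negP => /subset_leq_card/leq_trans/(_ (card_size s)).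
  by rewrite card_ord leqNgt (leq_trans s4).
have back i j k : P i j -> k != i -> k != j -> P j k.
  move=> Pij ki kj; have ij : i != j.
    by case: Pij => v <- <-; apply: centre_colour_neq.
  by apply: to_G2p_step (to_G2p_step Pij ki kj) _ _; rewrite eq_sym // eq_sym.
have change2 i j l : P i j -> l != i -> P i l.
  have [k] := fresh [:: i; j; l] isT; rewrite !inE !negb_or => /and3P[ki kj kl].
  by move=> /to_G2p_step/(_ ki kj)/back; apply; rewrite // eq_sym.
have change1 i j l : P i j -> l != j -> P l j.
  have [k] := fresh [:: i; j; l] isT; rewrite !inE !negb_or => /and3P[ki kj kl].
  by move=> /back/(_ ki kj)/to_G2p_step H lj; apply: H; rewrite // eq_sym.
(* If [x = b], the first entry cannot become [x] while the second is [b]; [back] first moves [b] to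
   the front. *)
move=> Pab; rewrite eq_sym => xy; case: (eqVneq x b) => [->|xb] in xy *.
  have [k] := fresh [:: a; b] isT; rewrite !inE !negb_or => /andP[ka kb].
  exact: change2 (back _ _ _ Pab ka kb) xy.
exact: change2 (change1 _ _ _ Pab xb) xy.
Qed.

Lemma to_G2p_iso : #|G| = #|G2p p| -> isomorphic G (G2p p).
Proof.
move=> cardG; have surj u : u \in codom to_G2p.
  have [v _] : exists v : G, v \in G.
    by apply/card_gt0P; rewrite cardG; apply/card_gt0P; exists u.
  have [w fw gw] :=
    @to_G2p_connected _ _ _ _ (ex_intro2 _ _ v erefl erefl) (valP u).
  by apply/codomP; exists w; apply: G2p_eq.
have inj : injective to_G2p.
  move=> v w; apply: (@image_injP _ _ to_G2p predT _ v w) => //.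
  rewrite cardG; apply/eqP/eq_card => u; rewrite surj.
  by rewrite inE.
exists to_G2p; first by apply: inj_card_bij; rewrite // cardG.
move=> v w; apply/idP/idP => [|/to_G2p_homo //].
(* Equal degrees make the injective homomorphism onto on neighbourhoods, so it also reflects
   adjacency. *)
have E : to_G2p @: [set w | adj v w] = [set u | adj (to_G2p v) u].
  apply/eqP; rewrite eqEcard card_imset // G2p_regular G_regular leqnn andbT.
  by apply/subsetP => _ /imsetP[x vx ->]; move: vx; rewrite !inE => /to_G2p_homo.
have := mem_imset [set w | adj v w] w inj.
by rewrite E !inE => ->.
Qed.

End CentreColour.
End Uniqueness.

(** * Hamiltonicity *)

(** A zigzag in the crown graph of pairs containing [n], where [(a, n)] and [(n, b)] are adjacent
    exactly when [a != b]. *)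
Fixpoint crown n i k : seq (nat * nat) :=
  if k is k'.+1 then [:: (i.+1, n), (n, i) & crown n i.+1 k'] else [::].

(** For [n] at least 4, a Hamiltonian path of this crown graph. The four initial entries let it
    start at [(n-1, n)] and end at [(n, n-3)], to fit the ends [(n-2, n-1)] and [(n-3, n-2)] of the
    previous cycle. *)
Definition new_arcs n :=
  [:: (n.-1, n); (n, n.-2); (0, n); (n, n.-1)] ++ crown n 0 n.-2.

(* [ham m] is a Hamiltonian cycle on the ordered pairs of symbols below [m + 4],
   starting at (m+2, m+3) and ending at (m+1, m+2). Reversal keeps the
   shape of the edge to be subdivided the same at every step. *)
Fixpoint ham m : seq (nat * nat) :=
  if m is m'.+1 then new_arcs (m' + 4) ++ rev (ham m') else
  [:: (2, 3); (0, 2); (1, 0); (2, 1); (1, 3); (3, 0);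
      (0, 1); (2, 0); (3, 2); (0, 3); (3, 1); (1, 2)].

Lemma mem_crown n i k a b : i + k < n ->
  ((a, b) \in crown n i k) =
  (b == n) && (i < a <= i + k) || (a == n) && (i <= b < i + k).
Proof.
elim: k i => [|k IH] i ikn /=; first by rewrite in_nil; lia.
by rewrite !inE !xpair_eqE IH; lia.
Qed.

Lemma crown_uniq n i k : i + k < n -> uniq (crown n i k).
Proof.
elim: k i => [|k IH] i ikn //=.
by rewrite !inE !xpair_eqE !mem_crown ?IH; lia.
Qed.

Lemma crown_path n i k j : j != i.+1 ->
  path (@arc_adj nat) (n, j) (crown n i k).
Proof.
elim: k i j => [|k IH] i j ji //=.
by rewrite IH /arc_adj /arc_succ /=; lia.
Qed.

Lemma last_crown n i k x :
  last x (crown n i k) = if k is 0 then x else (n, (i + k).-1).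
Proof.
elim: k i x => [|k IH] i x //=; rewrite IH.
by case: k {IH} => [|k]; congr pair; lia.
Qed.

Lemma mem_ham m a b :
  ((a, b) \in ham m) = [&& a < m + 4, b < m + 4 & a != b].
Proof.
elim: m => [|m IH].
  case: a => [|[|[|[|a]]]]; case: b => [|[|[|[|b]]]] //=.
rewrite /= !inE !xpair_eqE mem_cat mem_rev IH mem_crown; lia.
Qed.

Lemma ham_uniq m : uniq (ham m).
Proof.
elim: m => [//|m IH].
rewrite /= !inE !mem_cat !mem_rev !mem_ham !mem_crown; try lia.
rewrite cat_uniq rev_uniq IH crown_uniq ?andbT; try lia.
rewrite !xpair_eqE.
(* The old pairs only use symbols below [m + 4], so none is new. *)
suff -> : has (mem (crown (m + 4) 0 (m + 4).-2)) (rev (ham m)) = false by lia.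
apply/negbTE/hasPn => -[a b]; rewrite mem_rev mem_ham => /= ab.
by rewrite mem_crown; lia.
Qed.

Lemma head_ham m x : head x (ham m) = (m.+2, m.+3).
Proof. by case: m => //= m; congr pair; lia. Qed.

Lemma last_ham m x : last x (ham m) = (m.+1, m.+2).
Proof.
case: m => [//|m]; rewrite [ham _]/= /= last_cat.
have := head_ham m (0, 0); case: (ham m) => [//|y s] /= ->.
by rewrite rev_cons last_rcons.
Qed.

Lemma ham_cycle m : cycle (@arc_adj nat) (ham m).
Proof.
elim: m => [//|m IH].
have: cycle (@arc_adj nat) (rev (ham m)).
  by rewrite rev_cycle (eq_cycle (e' := @arc_adj nat)) // => x y; rewrite arc_adj_sym.
have := last_ham m (0, 0); have := head_ham m (0, 0).
rewrite [ham m.+1]/=; case/lastP: (ham m) => [|s y]; first by [].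
rewrite last_rcons rev_rcons => hd e.
have: last y (rev s) = (m.+2, m.+3).
  case: s hd => [/= hd|z s /= -> //]; last by rewrite rev_cons last_rcons.
  by move: e; rewrite hd => -[]; lia.
rewrite {}e => lst; rewrite /= !rcons_cat !cat_path /= !rcons_path lst last_crown.
(* The closing edge of the reversed old cycle is dropped, its path kept; the junctions with the new
   path remain to be checked. *)
case/andP=> -> _; rewrite crown_path; last by lia.
by rewrite (_ : m + 4 = m.+4) /arc_adj /arc_succ /=; lia.
Qed.

Lemma G2p_hamiltonian p : 1 < p -> hamiltonian (G2p p).
Proof.
(* With p = m + 2 the symbols are the numbers below m + 4, so [ham m] is pulled back along [h]. *)
case: p => [|[|m]] // _; pose h (u : G2p m.+2) : nat * nat :=
  (val (val u).1, val (val u).2).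
have h_inj : injective h.
  by move=> u v [/val_inj e1 /val_inj e2]; apply: G2p_eq.
have [c hc] : exists c, map h c = ham m.
  have : {subset ham m <= codom h}.
    move=> [a b]; rewrite mem_ham !addn4 => /and3P[am bm ab].
    have [|u Eu] := @G2p_sur _ (Ordinal am) (Ordinal bm); first exact: ab.
    by apply/codomP; exists u; rewrite /h Eu.
  elim: (ham m) => [|x s IH] sub; first by exists [::].
  have /codomP[u ->] := sub x (mem_head x s).
  have [z zs|c <-] := IH; last by exists (u :: c).
  by apply: sub; rewrite inE zs orbT.
exists c; split.
- by rewrite -(size_map h) hc; case: (m) => [|n].
- apply/andP; split; last by rewrite -(map_inj_uniq h_inj) hc ham_uniq.
  have := ham_cycle m; rewrite -hc cycle_map; congr is_true; apply: eq_cycle.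
  by move=> u v; rewrite G2p_adjE.
- move=> u; rewrite -(mem_map h_inj) hc mem_ham !addn4 !ltn_ord /=.
  exact: valP u.
Qed.

Theorem theorem4 (p : nat) (hp : 2 <= p) :
  [/\ [/\ regular (2 * p) (G2p p),
          star_colourable (p + 2) (G2p p) &
          #|G2p p| = (p + 1) * (p + 2)],
      (forall G : sgraph,
          regular (2 * p) G -> star_colourable (p + 2) G ->
          #|G| = (p + 1) * (p + 2) -> isomorphic G (G2p p)),
      vertex_transitive (G2p p),
      edge_transitive (G2p p) &
      hamiltonian (G2p p)].
Proof.
rewrite !addn1 !addn2; split.
- by split; [apply: G2p_regular | apply: G2p_star_colourable | apply: card_G2p].
- move=> G G_regular [f f_star] cardG.
  have [g gP] := centre_colour_exists hp G_regular f_star.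
  by apply: (to_G2p_iso hp G_regular f_star gP); rewrite card_G2p.
- exact: G2p_vertex_transitive.
- exact: G2p_edge_transitive.
- exact: G2p_hamiltonian.
Qed.
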